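(* $b(6)=6^{-6}$.
   Context: For a finite set $X$, $K_X$ is the complete graph on $X$, and a probability mass $\mu$ on $\binom{X}{2}$ is a function from the 2-element subsets of $X$ (edges of $K_X$) to $[0,1]$ with total sum $1$. For a graph $G$ and $m\geq 3$, $\mathcal C_m(G)$ is the set of (unlabeled) copies of the $m$-cycle $C_m$ in $G$. For a subgraph $G\subseteq K_X$, $\mu(G)=\prod_{e\in E(G)}\mu(e)$. Define $b(\mu;m)=\sum_{C\in\mathcal C_m(K_X)}\mu(C)$, and $b(m)=\sup\{b(\mu;m)\}$, the supremum over all finite sets $X$ and all probability masses $\mu$ on $\binom X2$. *)

(* Defs.v *)
From HB Require Import structures.
From mathcomp Require Import all_boot all_order all_algebra.
From mathcomp Require Import boolp classical_sets reals.

Set Implicit Arguments.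
Unset Strict Implicit.
Unset Printing Implicit Defensive.

Import Order.TTheory GRing.Theory Num.Theory.

Local Open Scope ring_scope.

(* A graph on the vertex type X is given by its edge set, a set of 2-element  *)
(* subsets of X. The subgraphs considered here, copies of cycles, have no     *)
(* isolated vertex, so they are determined by their edge sets.                *)

Definition complete_graph (X : finType) : {set {set X}} :=
  [set e : {set X} | #|e| == 2].

(* ordS is the cyclic successor on 'I_m; this is the m-cycle only for m >= 3. *)
Definition cycle_graph (m : nat) : {set {set 'I_m}} :=
  [set [set i; ordS i] | i : 'I_m].

Definition is_copy (Y X : finType) (H : {set {set Y}}) (C : {set {set X}}) :
    bool :=
  [exists f : {ffun Y -> X},
     injectiveb f && (C == [set f @: (e : {set Y}) | e in H])].

(* Unlabeled copies: each edge set is counted once, whatever the number of    *)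
(* injections that produce it.                                                *)
Definition cycle_copies (m : nat) (X : finType) (G : {set {set X}}) :
    {set {set {set X}}} :=
  [set C : {set {set X}} | (C \subset G) && is_copy (cycle_graph m) C].

(* Only the values of mu on complete_graph X are meaningful.                  *)
Definition prob_mass (R : realType) (X : finType) (mu : {set X} -> R) : Prop :=
  (forall e, e \in complete_graph X -> 0 <= mu e <= 1) /\
  \sum_(e in complete_graph X) mu e = 1.

Definition graph_mass (R : realType) (X : finType) (mu : {set X} -> R)
    (G : {set {set X}}) : R :=
  \prod_(e in G) mu e.

Definition cycle_mass (R : realType) (X : finType) (mu : {set X} -> R)
    (m : nat) : R :=
  \sum_(C in cycle_copies m (complete_graph X)) graph_mass mu C.

(* Real sup is 0 by convention on an empty or unbounded set, so an equation   *)
(* max_cycle_mass R m = c with c != 0 asserts a genuine least upper bound.    *)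
Definition max_cycle_mass (R : realType) (m : nat) : R :=
  sup [set r : R | exists (X : finType) (mu : {set X} -> R),
         prob_mass mu /\ r = cycle_mass mu m]%classic.

(* Main.v *)
Require Import Defs.
From HB Require Import structures.
From mathcomp Require Import all_boot all_order all_algebra.
From mathcomp Require Import boolp classical_sets reals.
From mathcomp Require Import ring lra.

Set Implicit Arguments.
Unset Strict Implicit.
Unset Printing Implicit Defensive.

Import Order.TTheory GRing.Theory Num.Theory.

Local Open Scope ring_scope.

(* Work with labelled cycles: let F(x_1,...,x_6) be the product of the weights of the
   cycle x_1...x_6 (0 unless the x_i are distinct), N its sum over all tuples, so that
   N >= 12 b(mu; 6), and let E(a,b) be the part of N with (x_1,x_2) = (a,b). Let D_i be
   the weight of the edges from x_i to vertices outside {x_1,...,x_i}. Exploring a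
   cycle greedily, F is w(x_1,x_2) D_2 D_3 D_4 D_5 w(x_6,x_1) times a kernel of total
   mass at most 1 in (x_3,...,x_6).
   If N <= 12 E(a,b) for some a, b, then AM-GM gives E(a,b) <= 6^-6, because
   w(x_1,x_2) + D_2 + ... + D_5 + w(x_6,x_1) <= 1 on distinct tuples.
   Otherwise no edge carries more than 1/6 of the cycle distribution F/N. Compare this
   distribution with the greedy one that starts from the edge marginal E/N, linearizing
   by prod z * (7 - sum z) <= 1: it remains to bound the F/N-averages of the D_i and of
   w(x_1,x_2). Rotation invariance of F gives av(D_i) <= av(deg) - av(w), and
   D_2 + ... + D_5 + deg(x_1) <= 1; hence 5 av(D_2 + ... + D_5) <= 4 (1 - av(w)),
   while av(w) <= 1/6 since the marginals are small. *)

(** AM-GM reduces this to [s ^+ 6 * (7 - 6 * s) <= 1] for the mean [s], with equality when all six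
    factors are 1. *)
Lemma prod6_tangent (R : realFieldType) (a b c d e f : R) :
  0 <= a -> 0 <= b -> 0 <= c -> 0 <= d -> 0 <= e -> 0 <= f ->
  a * b * c * d * e * f * (7 - (a + b + c + d + e + f)) <= 1.
Proof.
move=> a0 b0 c0 d0 e0 f0.
have p0 : 0 <= a * b * c * d * e * f by rewrite !mulr_ge0.
set S := a + b + c + d + e + f.
have [S7|S7] := leP 7 S.
  by apply: (le_trans _ ler01); rewrite mulr_ge0_le0 // subr_le0.
pose E (i : 'I_6) : R := nth 0 [:: a; b; c; d; e; f] i.
have E0 : {in predT, forall i, 0 <= E i}.
  by move=> [[|[|[|[|[|[|]]]]]] //= ?] _.
have [agm _] := leif_AGM E0; move: agm.
rewrite card_ord !big_ord_recl !big_ord0 /E /= mulr1 addr0 !addrA !mulrA -/S => agm.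
set s := S / 6 in agm.
have s0 : 0 <= s by rewrite /s /S divr_ge0 // !addr_ge0.
apply: (@le_trans _ _ (s ^+ 6 * (7 - S))).
  by apply: ler_wpM2r => //; rewrite subr_ge0 ltW.
have -> : S = 6 * s by rewrite /s; field.
rewrite -subr_ge0.
(* Tangency at [s = 1] yields the double root; the cofactor has only positive coefficients. *)
have -> : 1 - s ^+ 6 * (7 - 6 * s) =
  (1 - s) ^+ 2 * (1 + 2 * s + 3 * s ^+ 2 + 4 * s ^+ 3 + 5 * s ^+ 4 + 6 * s ^+ 5).
  by ring.
move: s s0 {agm} => s s0.
by rewrite mulr_ge0 ?sqr_ge0 ?addr_ge0 ?mulr_ge0 ?exprn_ge0 ?ler0n ?ler01.
Qed.

(** * Sums over 6-tuples *)

Section Sum6.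
Variables (R : realFieldType) (X : finType).
Implicit Types G H : X -> X -> X -> X -> X -> X -> R.

Definition sum6 G : R :=
  \sum_a \sum_b \sum_c \sum_d \sum_e \sum_f G a b c d e f.

Lemma eq_sum6 G H :
  (forall a b c d e f, G a b c d e f = H a b c d e f) -> sum6 G = sum6 H.
Proof. by move=> GH; do 6!(apply: eq_bigr => ? _). Qed.

Lemma ler_sum6 G H :
  (forall a b c d e f, G a b c d e f <= H a b c d e f) -> sum6 G <= sum6 H.
Proof. by move=> GH; do 6!(apply: ler_sum => ? _). Qed.

Lemma sum6D G H :
  sum6 (fun a b c d e f => G a b c d e f + H a b c d e f) = sum6 G + sum6 H.
Proof. by rewrite /sum6; do 6!(rewrite -big_split; apply: eq_bigr => ? _). Qed.

Lemma sum6N G : sum6 (fun a b c d e f => - G a b c d e f) = - sum6 G.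
Proof. by rewrite /sum6; do 6!(rewrite -sumrN; apply: eq_bigr => ? _). Qed.

Lemma sum6Z k G : sum6 (fun a b c d e f => k * G a b c d e f) = k * sum6 G.
Proof. by rewrite /sum6; do 6!(rewrite mulr_sumr; apply: eq_bigr => ? _). Qed.

Lemma sum6_rot G : sum6 (fun a b c d e f => G b c d e f a) = sum6 G.
Proof. by rewrite /sum6; do 5!(rewrite exchange_big; apply: eq_bigr => ? _). Qed.

Lemma sum_ffun6 G :
  \sum_(x : {ffun 'I_6 -> X})
     G (x (inord 0)) (x (inord 1)) (x (inord 2))
       (x (inord 3)) (x (inord 4)) (x (inord 5)) = sum6 G.
Proof.
rewrite /sum6 !pair_big /=.
pose h (t : X * X * X * X * X * X) : {ffun 'I_6 -> X} :=
  let: (a, b, c, d, e, f) := t in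
  [ffun i : 'I_6 => nth a [:: a; b; c; d; e; f] i].
rewrite (reindex h) /=.
  by apply: eq_bigr => -[[[[[a b] c] d] e] f] _; rewrite /h !ffunE !inordK.
exists (fun x : {ffun 'I_6 -> X} =>
  (x (inord 0), x (inord 1), x (inord 2), x (inord 3), x (inord 4), x (inord 5))).
  by move=> [[[[[a b] c] d] e] f] _; rewrite /h !ffunE !inordK.
move=> x _; apply/ffunP => i; rewrite /h ffunE.
by case: i => [[|[|[|[|[|[|]]]]]] //= i6]; congr (x _); apply: val_inj; rewrite /= inordK.
Qed.

End Sum6.

(** * The bound for labelled 6-cycles in a weighted graph *)

Section WeightedCycles.
Variables (R : realFieldType) (X : finType) (w : X -> X -> R).
Hypothesis wC : forall x y, w x y = w y x.
Hypothesis w0 : forall x, w x x = 0.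
Hypothesis w_ge0 : forall x y, 0 <= w x y.
Hypothesis w_total : \sum_x \sum_y w x y <= 2.
Implicit Types (S : seq X) (x y a b c d e f : X).

Definition outdeg S x : R := \sum_(y | y \notin S) w x y.

(** Ordered pairs are summed, so this is twice the mass of the edges avoiding [S]; hence the 2 in
    [w_total]. *)
Definition rest S : R := \sum_(x | x \notin S) \sum_(y | y \notin S) w x y.

(* 0 when [outdeg S x = 0], since division by 0 gives 0. *)
Definition step S x y : R := (y \notin S)%:R * w x y / outdeg S x.

Definition cycle6 a b c d e f : R :=
  (uniq [:: a; b; c; d; e; f])%:R *
  (w a b * w b c * w c d * w d e * w e f * w f a).

(** The greedy kernel: from the edge [a b], each next vertex is drawn outside the visited ones,
    proportionally to weight. The closing edge [f a] is left out. *)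
Definition path6 a b c d e f : R :=
  step [:: b; a] b c * (step [:: c; b; a] c d *
    (step [:: d; c; b; a] d e * step [:: e; d; c; b; a] e f)).

Definition edge6 a b : R := \sum_c \sum_d \sum_e \sum_f cycle6 a b c d e f.

Lemma outdeg_ge0 S x : 0 <= outdeg S x.
Proof. exact: sumr_ge0. Qed.

Lemma rest_ge0 S : 0 <= rest S.
Proof. by apply: sumr_ge0 => x _; apply: sumr_ge0. Qed.

Lemma rest_cons S x :
  x \notin S -> rest S = rest (x :: S) + outdeg (x :: S) x *+ 2.
Proof.
move=> xS.
have E (g : X -> R) :
    \sum_(y | y \notin S) g y = g x + \sum_(y | y \notin x :: S) g y.
  rewrite (bigD1 x) //=; congr (_ + _).
  by apply: eq_bigl => y; rewrite inE negb_or andbC.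
rewrite /rest E E w0 add0r (eq_bigr _ (fun y _ => E (w y))) big_split /=.
rewrite (eq_bigr (w x) (fun y _ => wC y x)) -/(outdeg (x :: S) x).
by rewrite addrA addrC mulr2n.
Qed.

Lemma step_ge0 S x y : 0 <= step S x y.
Proof. by rewrite /step divr_ge0 ?mulr_ge0 ?outdeg_ge0. Qed.

(** The cancellation survives division by zero: if [outdeg S x = 0], its nonnegative terms all
    vanish. *)
Lemma stepK S x y : step S x y * outdeg S x = (y \notin S)%:R * w x y.
Proof.
rewrite /step; have [D0|/divfK //] := eqVneq (outdeg S x) 0.
have [_|yS] := boolP (y \in S); first by rewrite !mul0r.
have wxy0 : w x y = 0.
  apply/eqP; move: D0 => /eqP; rewrite psumr_eq0 // => /allP /(_ y).
  by rewrite mem_index_enum yS => /(_ isT).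
by rewrite D0 wxy0 !mulr0.
Qed.

Lemma sum_step_le1 S x : \sum_y step S x y <= 1.
Proof.
rewrite -mulr_suml.
have -> : \sum_y (y \notin S)%:R * w x y = outdeg S x.
  rewrite /outdeg [RHS]big_mkcond; apply: eq_bigr => y _.
  by case: ifP; rewrite ?mul1r ?mul0r.
by have [->|D0] := eqVneq (outdeg S x) 0; rewrite ?mul0r ?ler01 ?divff ?lexx.
Qed.

Lemma path6_ge0 a b c d e f : 0 <= path6 a b c d e f.
Proof. by do 3!(apply: mulr_ge0; first exact: step_ge0); exact: step_ge0. Qed.

Lemma sum_path6_le1 a b :
  \sum_c \sum_d \sum_e \sum_f path6 a b c d e f <= 1.
Proof.
(* Averaging against a subprobability kernel keeps values in [0, 1]; this is applied four times,
   from the inside out. *)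
have step_avg S x (g : X -> R) : (forall y, 0 <= g y <= 1) ->
    0 <= \sum_y step S x y * g y <= 1.
  move=> g01; apply/andP; split.
    apply: sumr_ge0 => y _; case/andP: (g01 y) => ? _.
    by rewrite mulr_ge0 ?step_ge0.
  apply: le_trans (sum_step_le1 S x); apply: ler_sum => y _.
  by case/andP: (g01 y) => _ ?; rewrite ler_piMr ?step_ge0.
have -> : \sum_c \sum_d \sum_e \sum_f path6 a b c d e f =
    \sum_c step [:: b; a] b c * \sum_d step [:: c; b; a] c d *
      \sum_e step [:: d; c; b; a] d e * \sum_f step [:: e; d; c; b; a] e f * 1.
  apply: eq_bigr => c _; rewrite mulr_sumr; apply: eq_bigr => d _.
  rewrite !mulr_sumr; apply: eq_bigr => e _.
  by rewrite !mulr_sumr; apply: eq_bigr => f _; rewrite mulr1.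
have /andP[_ //] : 0 <= \sum_c step [:: b; a] b c * \sum_d step [:: c; b; a] c d *
      \sum_e step [:: d; c; b; a] d e * \sum_f step [:: e; d; c; b; a] e f * 1 <= 1.
by do 4!(apply: (step_avg _ _ _) => ?); rewrite ler01 lexx.
Qed.

Lemma cycle6E a b c d e f :
  cycle6 a b c d e f = path6 a b c d e f *
    (w a b * outdeg [:: b; a] b * outdeg [:: c; b; a] c *
     outdeg [:: d; c; b; a] d * outdeg [:: e; d; c; b; a] e * w f a).
Proof.
have -> : path6 a b c d e f *
    (w a b * outdeg [:: b; a] b * outdeg [:: c; b; a] c *
     outdeg [:: d; c; b; a] d * outdeg [:: e; d; c; b; a] e * w f a) =
   w a b * (step [:: b; a] b c * outdeg [:: b; a] b) *
   (step [:: c; b; a] c d * outdeg [:: c; b; a] c) *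
   (step [:: d; c; b; a] d e * outdeg [:: d; c; b; a] d) *
   (step [:: e; d; c; b; a] e f * outdeg [:: e; d; c; b; a] e) * w f a.
  by rewrite /path6; ring.
rewrite !stepK /cycle6.
(* The kernel never tests [a != b]; the factor [w a b] handles that case. The other distinctness
   conditions are exactly the tests in the four steps. *)
have [<-|ab] := eqVneq a b; first by rewrite w0 !mul0r mulr0.
have -> : uniq [:: a; b; c; d; e; f] =
    [&& c \notin [:: b; a], d \notin [:: c; b; a], e \notin [:: d; c; b; a]
      & f \notin [:: e; d; c; b; a]].
  rewrite -(rev_uniq [:: a; b; c; d; e; f]) /= mem_seq1 (eq_sym b a) ab /= andbT.
  by rewrite andbC -!andbA; do !bool_congr.
by do 4!case: (_ \notin _); rewrite /= ?mul0r ?mulr0 ?mul0r ?mul1r.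
Qed.

Lemma cycle6_ge0 a b c d e f : 0 <= cycle6 a b c d e f.
Proof. by rewrite /cycle6 !mulr_ge0. Qed.

Lemma cycle6_rot a b c d e f : cycle6 b c d e f a = cycle6 a b c d e f.
Proof.
rewrite /cycle6 -(rot_uniq 1 [:: a; b; c; d; e; f]); congr (_ * _); ring.
Qed.

Lemma outdeg_le_prev S x y :
  y \in S -> outdeg S x <= outdeg [::] x - w y x.
Proof.
move=> yS; rewrite wC /outdeg [X in _ <= X - _](bigD1 y) //= addrAC subrr add0r.
rewrite [leLHS]big_mkcond [leRHS]big_mkcond; apply: ler_sum => z _.
by have [->|_] := eqVneq z y; rewrite ?yS //=; case: ifP.
Qed.

Lemma outdeg_nil_ge a b f : b != f -> w a b + w f a <= outdeg [::] a.
Proof.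
move=> bf; rewrite wC (wC f) /outdeg (bigD1 b) //= (bigD1 f) ?(eq_sym f) //=.
by rewrite addrA wC ler_wpDr // sumr_ge0.
Qed.

(** Charging each edge to its first visited endpoint makes the five edge sets disjoint, and the
    total edge mass is at most 1. *)
Lemma outdeg_path_le a b c d e : uniq [:: e; d; c; b; a] ->
  outdeg [::] a + outdeg [:: b; a] b + outdeg [:: c; b; a] c +
  outdeg [:: d; c; b; a] d + outdeg [:: e; d; c; b; a] e <= 1.
Proof.
rewrite !cons_uniq => /and5P[eS dS cS bS /andP[aS _]].
have total : rest [::] <= 2 by [].
have := rest_ge0 [:: e; d; c; b; a].
have -> : outdeg [::] a = outdeg [:: a] a.
  rewrite /outdeg (bigD1 a) //= w0 add0r.
  by apply: eq_bigl => y; rewrite mem_seq1.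
move: total; rewrite (rest_cons aS) (rest_cons bS) (rest_cons cS) (rest_cons dS).
by rewrite (rest_cons eS); lra.
Qed.

Definition outdegs a b c d e : R :=
  outdeg [:: b; a] b + outdeg [:: c; b; a] c +
  outdeg [:: d; c; b; a] d + outdeg [:: e; d; c; b; a] e.

(* The parameter [t] absorbs the ratio between [w a b] and the edge marginal. *)
Lemma cycle6_tangent t a b c d e f : 0 <= t ->
  t * 6 ^+ 5 * (cycle6 a b c d e f *
    (7 - t * w a b - 6 * outdegs a b c d e - 6 * w f a)) <= path6 a b c d e f.
Proof.
move=> t0; rewrite cycle6E /outdegs.
have := path6_ge0 a b c d e f; set p := path6 _ _ _ _ _ _ => p0.
have := outdeg_ge0 [:: b; a] b; set D2 := outdeg [:: b; a] b => D20.
have := outdeg_ge0 [:: c; b; a] c; set D3 := outdeg [:: c; b; a] c => D30.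
have := outdeg_ge0 [:: d; c; b; a] d; set D4 := outdeg [:: d; c; b; a] d => D40.
have := outdeg_ge0 [:: e; d; c; b; a] e.
set D5 := outdeg [:: e; d; c; b; a] e => D50.
have six (x : R) : 0 <= x -> 0 <= 6 * x by move=> ?; rewrite mulr_ge0.
have := prod6_tangent (mulr_ge0 t0 (w_ge0 a b)) (six _ D20) (six _ D30)
  (six _ D40) (six _ D50) (six _ (w_ge0 f a)).
move=> /(ler_wpM2l p0); rewrite mulr1; apply: le_trans.
by rewrite le_eqVlt; apply/orP; left; apply/eqP; ring.
Qed.

Lemma outdegs_le a b c d e f : uniq [:: a; b; c; d; e; f] ->
  outdegs a b c d e <= 1 - outdeg [::] a.
Proof.
rewrite -[[:: a; b; c; d; e; f]]/(rcons [:: a; b; c; d; e] f) rcons_uniq.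
move=> /andP[_]; rewrite -rev_uniq => /outdeg_path_le.
by rewrite /outdegs; lra.
Qed.

Lemma cycle6_not_uniq a b c d e f :
  ~~ uniq [:: a; b; c; d; e; f] -> cycle6 a b c d e f = 0.
Proof. by rewrite /cycle6 => /negbTE->; rewrite mul0r. Qed.

Lemma cycle6_le_path6 a b c d e f :
  6 ^+ 6 * cycle6 a b c d e f <= path6 a b c d e f.
Proof.
have [uniq6|/cycle6_not_uniq->] := boolP (uniq [:: a; b; c; d; e; f]); last first.
  by rewrite mulr0 path6_ge0.
have six0 : 0 <= 6 :> R by [].
(* With [t = 6] the linear factor is at least 1: [w a b + w f a] is at most [outdeg [::] a], which
   together with [outdegs] is at most 1. *)
apply: le_trans (cycle6_tangent a b c d e f six0).
rewrite -exprS ler_wpM2l ?exprn_ge0 // ler_peMr ?cycle6_ge0 //.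
have bf : b != f.
  by apply: contraTneq uniq6 => ->; rewrite /= !inE eqxx !orbT /= andbF.
by have := outdegs_le uniq6; have := outdeg_nil_ge a bf; lra.
Qed.

Lemma edge6_le a b : edge6 a b <= 6 ^- 6.
Proof.
rewrite -[leRHS]mul1r ler_pdivlMr ?exprn_gt0 // mulrC.
apply: le_trans (sum_path6_le1 a b).
do 4!(rewrite mulr_sumr; apply: ler_sum => ? _).
exact: cycle6_le_path6.
Qed.

Lemma edge6_ge0 a b : 0 <= edge6 a b.
Proof. by do 4!(apply: sumr_ge0 => ? _); apply: cycle6_ge0. Qed.

(** Used when an edge marginal vanishes: all cycles starting with that edge then vanish too. *)
Lemma cycle6_le_edge6 a b c d e f : cycle6 a b c d e f <= edge6 a b.
Proof.
have term (g : X -> R) y : (forall z, 0 <= g z) -> g y <= \sum_z g z.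
  by move=> g0; rewrite (bigD1 y) //= lerDl sumr_ge0.
rewrite /edge6; do 4!(apply: le_trans (term _ _ _); last first;
  [by move=> ?; do ?(apply: sumr_ge0 => ? _); apply: cycle6_ge0 | ]).
exact: lexx.
Qed.

Lemma sum6_cycle6_edge (g : X -> X -> R) :
  sum6 (fun a b c d e f => cycle6 a b c d e f * g a b) =
  \sum_a \sum_b edge6 a b * g a b.
Proof.
apply: eq_bigr => a _; apply: eq_bigr => b _.
by rewrite /edge6; do 4!(rewrite mulr_suml; apply: eq_bigr => ? _).
Qed.

Lemma sum6_cycle6_rot (H : X -> X -> X -> X -> X -> X -> R) :
  sum6 (fun a b c d e f => cycle6 a b c d e f * H b c d e f a) =
  sum6 (fun a b c d e f => cycle6 a b c d e f * H a b c d e f).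
Proof.
rewrite -[RHS]sum6_rot; apply: eq_sum6 => a b c d e f.
by rewrite -cycle6_rot.
Qed.

Lemma outdegs_le_prev a b c d e : outdegs a b c d e <=
  (outdeg [::] b - w a b) + (outdeg [::] c - w b c) +
  (outdeg [::] d - w c d) + (outdeg [::] e - w d e).
Proof. by rewrite /outdegs !lerD // outdeg_le_prev // !inE eqxx ?orbT. Qed.

(** Two bounds, [S <= N - D] and [S <= 4 * (D - T)], are combined with weights 4 and 1 so as to
    eliminate [D]. *)
Lemma sum6_cycle6_outdegs_le :
  5 * sum6 (fun a b c d e f => cycle6 a b c d e f * outdegs a b c d e) <=
  4 * (sum6 cycle6 - sum6 (fun a b c d e f => cycle6 a b c d e f * w a b)).
Proof.
set S := sum6 _; set N := sum6 _; set T := sum6 _.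
pose D := sum6 (fun a b c d e f => cycle6 a b c d e f * outdeg [::] a).
have S_le1 : S <= N - D.
  rewrite /N /D -sum6N -sum6D; apply: ler_sum6 => a b c d e f.
  have [uniq6|/cycle6_not_uniq->] := boolP (uniq [:: a; b; c; d; e; f]); last first.
    by rewrite !mul0r subr0.
  rewrite -[X in _ <= X - _]mulr1 -mulrBr ler_wpM2l ?cycle6_ge0 //.
  exact: outdegs_le uniq6.
pose g a b := outdeg [::] b - w a b.
pose U := sum6 (fun a b c d e f => cycle6 a b c d e f * g a b).
have UE : U = D - T.
  rewrite /U /D -[in RHS]sum6_cycle6_rot -sum6N -sum6D.
  by apply: eq_sum6 => a b c d e f; rewrite mulrBr.
have U1 : sum6 (fun a b c d e f => cycle6 a b c d e f * g b c) = U.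
  by rewrite (sum6_cycle6_rot (fun a b c d e f => g a b)).
have U2 : sum6 (fun a b c d e f => cycle6 a b c d e f * g c d) = U.
  by rewrite (sum6_cycle6_rot (fun a b c d e f => g b c)).
have U3 : sum6 (fun a b c d e f => cycle6 a b c d e f * g d e) = U.
  by rewrite (sum6_cycle6_rot (fun a b c d e f => g c d)).
have S_le2 : S <= U + U + U + U.
  rewrite -{2}U1 -{2}U2 -{2}U3 -!sum6D; apply: ler_sum6 => a b c d e f.
  by rewrite -!mulrDr ler_wpM2l ?cycle6_ge0 // outdegs_le_prev.
by move: S_le1 S_le2; rewrite UE; lra.
Qed.

Lemma sum6_cycle6_le : sum6 cycle6 <= 12 / 6 ^+ 6.
Proof.
set N := sum6 cycle6.
have [N0|N0] := leP N 0; first by apply: le_trans N0 _; rewrite divr_ge0 ?exprn_ge0.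
(* The threshold is attained by a single hexagon, where each oriented edge starts one of the 12
   labellings. *)
have [/existsP[a /existsP[b ab]]|] := boolP [exists a, exists b, N <= 12 * edge6 a b].
  by apply: le_trans ab _; rewrite ler_wpM2l // edge6_le.
rewrite negb_exists => /forallP small.
have {}small a b : 12 * edge6 a b <= N.
  by have := small a; rewrite negb_exists => /forallP/(_ b); rewrite -ltNge => /ltW.
pose T := sum6 (fun a b c d e f => cycle6 a b c d e f * w a b).
pose S := sum6 (fun a b c d e f => cycle6 a b c d e f * outdegs a b c d e).
have T_le : 6 * T <= N.
  rewrite /T sum6_cycle6_edge.
  apply: (@le_trans _ _ (6 * \sum_a \sum_b N / 12 * w a b)).
    rewrite ler_wpM2l //; do 2!(apply: ler_sum => ? _).
    by rewrite ler_wpM2r // ler_pdivlMr // mulrC.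
  under eq_bigr do rewrite -mulr_sumr.
  rewrite -mulr_sumr mulrA.
  apply: le_trans (ler_wpM2l _ w_total) _; last by lra.
  by rewrite mulr_ge0 // divr_ge0 // ltW.
have TE : sum6 (fun a b c d e f => cycle6 a b c d e f * w f a) = T.
  by rewrite -(sum6_cycle6_rot (fun a b c d e f => w f a)).
have S_le : 5 * S <= 4 * (N - T) := sum6_cycle6_outdegs_le.
(* This is [t * w a b] for [t = N / (2 * edge6 a b)], chosen so that the edge marginal cancels and
   [w_total] bounds the sum. *)
pose r a b := N / (2 * edge6 a b) * w a b.
have V_le : sum6 (fun a b c d e f => cycle6 a b c d e f * r a b) <= N.
  rewrite sum6_cycle6_edge.
  apply: (@le_trans _ _ (\sum_a \sum_b N / 2 * w a b)).
    do 2!(apply: ler_sum => ? _); rewrite /r mulrA ler_wpM2r //.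
    set x := edge6 _ _; have [->|x0] := eqVneq x 0; first by rewrite mul0r divr_ge0 // ltW.
    by rewrite le_eqVlt; apply/orP; left; apply/eqP; field.
  under eq_bigr do rewrite -mulr_sumr.
  rewrite -mulr_sumr; apply: le_trans (ler_wpM2l _ w_total) _; last by lra.
  by rewrite divr_ge0 // ltW.
have pointwise a b c d e f :
    cycle6 a b c d e f * (7 - r a b - 6 * outdegs a b c d e - 6 * w f a) <=
    2 * edge6 a b / N / 6 ^+ 5 * path6 a b c d e f.
  have [x0|x0] := eqVneq (edge6 a b) 0.
    have := cycle6_le_edge6 a b c d e f; rewrite x0 => c0.
    have -> : cycle6 a b c d e f = 0 by apply/eqP; rewrite eq_le c0 cycle6_ge0.
    by rewrite !(mul0r, mulr0).
  have xgt0 : 0 < edge6 a b by rewrite lt0r x0 edge6_ge0.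
  have t0 : 0 <= N / (2 * edge6 a b) by rewrite divr_ge0 ?mulr_ge0 ?edge6_ge0 // ltW.
  have := cycle6_tangent a b c d e f t0; rewrite -/(r a b).
  have k0 : 0 <= 2 * edge6 a b / N / 6 ^+ 5.
    by rewrite !divr_ge0 ?mulr_ge0 ?exprn_ge0 ?edge6_ge0 // ltW.
  move=> /(ler_wpM2l k0); apply: le_trans; rewrite mulrA.
  have -> : 2 * edge6 a b / N / 6 ^+ 5 * (N / (2 * edge6 a b) * 6 ^+ 5) = 1.
    by field; rewrite x0 gt_eqF.
  by rewrite mul1r.
have := ler_sum6 pointwise.
have -> : sum6 (fun a b c d e f => cycle6 a b c d e f *
      (7 - r a b - 6 * outdegs a b c d e - 6 * w f a)) =
    7 * N - sum6 (fun a b c d e f => cycle6 a b c d e f * r a b) - 6 * S - 6 * T.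
  rewrite -TE /N /S -!sum6Z -!sum6N -!sum6D.
  by apply: eq_sum6 => a b c d e f; ring.
(* The kernel sums to at most 1 and the edge marginals to [N], which leaves 2 / 6^5. *)
have path_le : sum6 (fun a b c d e f => 2 * edge6 a b / N / 6 ^+ 5 * path6 a b c d e f)
    <= 12 / 6 ^+ 6.
  apply: (@le_trans _ _ (\sum_a \sum_b 2 * edge6 a b / N / 6 ^+ 5)).
    do 2!(apply: ler_sum => ? _).
    under eq_bigr do under eq_bigr do under eq_bigr do rewrite -mulr_sumr.
    under eq_bigr do under eq_bigr do rewrite -mulr_sumr.
    under eq_bigr do rewrite -mulr_sumr.
    rewrite -mulr_sumr ler_piMr ?sum_path6_le1 //.
    by rewrite !divr_ge0 ?mulr_ge0 ?exprn_ge0 ?edge6_ge0 // ltW.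
  have -> : \sum_a \sum_b 2 * edge6 a b / N / 6 ^+ 5 =
      2 / N / 6 ^+ 5 * \sum_a \sum_b edge6 a b.
    do 2!(rewrite mulr_sumr; apply: eq_bigr => ? _).
    by ring.
  have -> : \sum_a \sum_b edge6 a b = N by [].
  by rewrite le_eqVlt; apply/orP; left; apply/eqP; field; rewrite gt_eqF.
(* The left side is at least 6N - (24/5)(N - T) - 6T = (6/5)(N - T), which is at least N since 6T <=
   N. *)
by lra.
Qed.

End WeightedCycles.

(** * Copies of the hexagon and their labellings *)

Definition cycle_image (m : nat) (X : finType) (x : 'I_m -> X) : {set {set X}} :=
  [set [set x i; x (ordS i)] | i : 'I_m].

Lemma imset_cycle_graph (m : nat) (X : finType) (x : 'I_m -> X) :
  [set x @: (e : {set 'I_m}) | e in cycle_graph m] = cycle_image x.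
Proof.
rewrite /cycle_graph -imset_comp; apply: eq_imset => i /=.
by rewrite imsetU1 imset_set1.
Qed.

Lemma ordS6E (i : 'I_6) : ordS i = i + 1.
Proof. by apply: val_inj; case: i => [[|[|[|[|[|[|]]]]]] //]. Qed.

(** Distinct indices giving the same edge would be successors of each other, forcing 2 = 0 modulo
    6. *)
Lemma cycle_edge6_inj : injective (fun i : 'I_6 => [set i; ordS i]).
Proof.
move=> i j /= /setP eq_ij.
have := eq_ij i; have := eq_ij (ordS i).
rewrite !inE !eqxx /= orbT => /esym.
have [-> //|] := eqVneq i j; rewrite !ordS6E (inj_eq (addIr 1)) => /negPf ->.
rewrite orbF => /eqP <- /esym /eqP /(congr1 val).
by case: i {eq_ij} => [[|[|[|[|[|[|]]]]]] //].
Qed.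

Lemma cycle_image6_inj (X : finType) (x : 'I_6 -> X) :
  injective x -> injective (fun i => [set x i; x (ordS i)]).
Proof.
move=> x_inj i j /= eq_ij; apply: cycle_edge6_inj => /=.
by apply: (imset_inj x_inj); rewrite !imsetU1 !imset_set1.
Qed.

Lemma cycle_image_complete (X : finType) (x : 'I_6 -> X) :
  injective x -> cycle_image x \subset complete_graph X.
Proof.
move=> x_inj; apply/fintype.subsetP => _ /imsetP[i _ ->].
rewrite inE cards2 (inj_eq x_inj) ordS6E.
by case: i => [[|[|[|[|[|[|]]]]]] //].
Qed.

Lemma cycle_copies6P (X : finType) (C : {set {set X}}) :
  reflect (exists2 x : {ffun 'I_6 -> X}, injective x & C = cycle_image x)
          (C \in cycle_copies 6 (complete_graph X)).
Proof.
rewrite inE; apply: (iffP andP) => [[_ /existsP[x /andP[/injectiveP x_inj /eqP ->]]]|].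
  by exists x => //; rewrite imset_cycle_graph.
move=> [x x_inj ->]; split; first exact: cycle_image_complete.
apply/existsP; exists x; rewrite imset_cycle_graph eqxx andbT.
exact/injectiveP.
Qed.

(** The twelve symmetries of the hexagon: the boolean selects rotation or reflection. *)
Definition dihedral (kb : 'I_6 * bool) (i : 'I_6) : 'I_6 :=
  if kb.2 then kb.1 + i else kb.1 - i.

Lemma dihedral_inj kb : injective (dihedral kb).
Proof.
by case: kb => k [] i j; rewrite /dihedral /= => /addrI // /oppr_inj.
Qed.

Lemma cycle_image_dihedral (X : finType) (x : 'I_6 -> X) kb :
  cycle_image (x \o dihedral kb) = cycle_image x.
Proof.
case: kb => k b; apply/setP => e.
apply/imsetP/imsetP => -[i _ ->]; case: b; rewrite /dihedral /=.
- by exists (k + i) => //; rewrite !ordS6E addrA.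
(* A reflection reverses edges, so the successor of [i] is sent to the starting point; hence the
   shift by 1. *)
- by exists (k - i - 1) => //; rewrite !ordS6E opprD addrA subrK finset.setUC.
- by exists (i - k) => //; rewrite !ordS6E (addrA k _ 1) (addrC k (i - k)) subrK.
- exists (k - i - 1) => //.
  by rewrite !ordS6E subrK -addrA -opprD !subKr finset.setUC.
Qed.

Lemma card_cycle_image (X : finType) (C : {set {set X}}) :
  C \in cycle_copies 6 (complete_graph X) ->
  (12 <= #|[pred x : {ffun 'I_6 -> X} | injectiveb x && (cycle_image x == C)]|)%N.
Proof.
move=> /cycle_copies6P[x x_inj ->].
pose h kb : {ffun 'I_6 -> X} := [ffun i => x (dihedral kb i)].
have h_inj : injective h.
  move=> [k b] [l c] /ffunP hkl.
  (* The value at 0 determines the shift, and the value at 1 the orientation, as 1 and -1 differ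
     modulo 6. *)
  have := hkl 0; have := hkl 1; rewrite !ffunE => /x_inj + /x_inj.
  rewrite /dihedral; case: b c {hkl} => -[]; rewrite /= ?addr0 ?subr0 => + kl; rewrite kl //.
    by move=> /addrI.
  by move=> /addrI.
have -> : 12%N = #|[set h kb | kb in {: 'I_6 * bool}]|.
  by rewrite card_imset // card_prod card_ord card_bool.
apply/subset_leq_card/fintype.subsetP => _ /imsetP[kb _ ->]; rewrite inE; apply/andP; split.
  by apply/injectiveP => i j; rewrite !ffunE => /x_inj/dihedral_inj.
rewrite -(cycle_image_dihedral x kb); apply/eqP/eq_imset => i.
by rewrite !ffunE.
Qed.

(** * From a mass on edges to labelled cycles *)

Section LabelledCycles.
Variables (R : realType) (X : finType) (mu : {set X} -> R).
Hypothesis mu_ge0 : forall e, e \in complete_graph X -> 0 <= mu e.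

(** [mu] is unconstrained on singletons, so the diagonal is masked. *)
Definition edge_weight (x y : X) : R := if x == y then 0 else mu [set x; y].

Lemma edge_weightC x y : edge_weight x y = edge_weight y x.
Proof. by rewrite /edge_weight eq_sym finset.setUC. Qed.

Lemma edge_weight_refl x : edge_weight x x = 0.
Proof. by rewrite /edge_weight eqxx. Qed.

Lemma edge_weight_ge0 x y : 0 <= edge_weight x y.
Proof.
rewrite /edge_weight; have [//|xy] := eqVneq x y.
by apply: mu_ge0; rewrite inE cards2 xy.
Qed.

Lemma sum_edge_weight :
  \sum_x \sum_y edge_weight x y = 2 * \sum_(e in complete_graph X) mu e.
Proof.
rewrite pair_big /=.
rewrite (bigID (fun p : X * X => p.1 == p.2)) /= big1 ?add0r; last first.
  by move=> p /eqP; rewrite /edge_weight => ->; rewrite eqxx.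
(* Ordered pairs are grouped by underlying edge; each fibre is a pair and its swap. *)
rewrite (partition_big (fun p : X * X => [set p.1; p.2]) (mem (complete_graph X))) /=;
  last by move=> p p12; rewrite inE cards2 p12.
rewrite mulr_sumr; apply: eq_bigr => e; rewrite inE => /cards2P[a [b [ab ->]]].
have bNa : b == a = false by rewrite eq_sym (negPf ab).
rewrite (bigD1 (a, b)) /=; last by rewrite ab eqxx.
rewrite (bigD1 (b, a)) /=; last by rewrite bNa finset.setUC eqxx /= xpair_eqE bNa.
rewrite big1; last first.
  move=> [c d] /= /andP[/andP[/andP[cd /eqP/setP cdE] c1] c2]; exfalso.
  have := cdE c; have := cdE d; rewrite !inE !eqxx orbT /=.
  move: c1 c2 cd; rewrite !xpair_eqE.
  have [->|ca] := eqVneq c a; have [->|da] := eqVneq d a; rewrite ?eqxx ?(negPf ab) //=.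
    by move=> /negPf ->.
    by move=> _ + _ _ /esym; rewrite andbT => /negPf ->.
  by move=> _ _ /eqP cd /esym/eqP db /esym/eqP cb; apply: cd; rewrite cb db.
by rewrite addr0 mulr_natl mulr2n (edge_weightC b) /edge_weight (negPf ab).
Qed.

(** Injections are grouped by image; each copy has at least twelve labellings, and its mass is
    nonnegative. *)
Lemma cycle_mass_le_labelled :
  12 * cycle_mass mu 6 <=
  \sum_(x : {ffun 'I_6 -> X} | injectiveb x) \prod_i mu [set x i; x (ordS i)].
Proof.
have massE (x : {ffun 'I_6 -> X}) : injectiveb x ->
    \prod_i mu [set x i; x (ordS i)] = graph_mass mu (cycle_image x).
  move=> /injectiveP x_inj; rewrite /graph_mass /cycle_image big_imset //=.
  by move=> i j _ _; apply: cycle_image6_inj.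
rewrite (eq_bigr _ massE).
rewrite (partition_big (fun x : {ffun 'I_6 -> X} => cycle_image x)
  (mem (cycle_copies 6 (complete_graph X)))) /=; last first.
  by move=> x /injectiveP x_inj; apply/cycle_copies6P; exists x.
rewrite /cycle_mass mulr_sumr; apply: ler_sum => C CC.
rewrite (eq_bigr (fun=> graph_mass mu C)); last by move=> x /andP[_ /eqP ->].
rewrite sumr_const -[leRHS]mulr_natl ler_wpM2r ?ler_nat ?card_cycle_image //.
apply: prodr_ge0 => e eC; apply: mu_ge0.
by move: CC; rewrite inE => /andP[/fintype.subsetP/(_ e eC)].
Qed.

Lemma enum_ord6 : enum 'I_6 = map inord (iota 0 6).
Proof.
apply: (inj_map val_inj); rewrite val_enum_ord -map_comp -[LHS]map_id.
by apply/eq_in_map => i; rewrite mem_iota /= => ?; rewrite inordK.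
Qed.

Lemma sum_labelled6 :
  \sum_(x : {ffun 'I_6 -> X} | injectiveb x) \prod_i mu [set x i; x (ordS i)] =
  sum6 (cycle6 edge_weight).
Proof.
rewrite -sum_ffun6 big_mkcond; apply: eq_bigr => x _.
rewrite /cycle6.
have -> : injectiveb x = uniq [:: x (inord 0); x (inord 1); x (inord 2);
    x (inord 3); x (inord 4); x (inord 5)].
  by rewrite /injectiveb /dinjectiveb enum_ord6.
case: ifP => [|_]; last by rewrite mul0r.
rewrite -big_enum enum_ord6 /= !big_cons big_nil mulr1 mul1r !mulrA.
have ordS_inord k : (k < 6)%N -> ordS (inord k : 'I_6) = inord (k.+1 %% 6).
  by move=> k6; apply: val_inj; rewrite /= !inordK // ltn_mod.
rewrite !ordS_inord //= /edge_weight !inE !negb_or.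
move=> /and5P[/and5P[/negPf-> _ _ _ f0] /and4P[/negPf-> _ _ _] /and3P[/negPf-> _ _]
  /andP[/negPf-> _] /andP[/negPf-> _]].
by rewrite eq_sym (negPf f0).
Qed.

End LabelledCycles.

(** * The upper bound, the extremal example and the supremum *)

Lemma cycle_mass6_le (R : realType) (X : finType) (mu : {set X} -> R) :
  prob_mass mu -> cycle_mass mu 6 <= 6 ^- 6.
Proof.
move=> [mu01 mu1].
have mu_ge0 e : e \in complete_graph X -> 0 <= mu e by move=> /mu01/andP[].
have := cycle_mass_le_labelled mu_ge0; rewrite sum_labelled6.
have total : \sum_x \sum_y edge_weight mu x y <= 2.
  by rewrite sum_edge_weight mu1 mulr1.
have := sum6_cycle6_le (edge_weightC mu) (edge_weight_refl mu)
  (edge_weight_ge0 mu_ge0) total.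
by move=> le1 le2; have := le_trans le2 le1; lra.
Qed.

Lemma uniform_cycle6 (R : realType) :
  exists (X : finType) (mu : {set X} -> R),
    prob_mass mu /\ 6 ^- 6 <= cycle_mass mu 6.
Proof.
(* The extremal mass is uniform on one hexagon, whose own copy already contributes [6 ^- 6]. *)
pose mu (e : {set 'I_6}) : R := (e \in cycle_graph 6)%:R / 6.
have idE : cycle_graph 6 = cycle_image (@id 'I_6) by [].
have idK : injective (@id 'I_6) by [].
have card6 : #|cycle_graph 6| = 6%N.
  by rewrite card_imset ?card_ord //; apply: cycle_edge6_inj.
have sub6 : cycle_graph 6 \subset complete_graph 'I_6.
  by rewrite idE cycle_image_complete.
exists 'I_6, mu; split.
  split=> [e _|]; first by rewrite /mu; case: (_ \in _); rewrite ?mul0r ?mul1r; apply/andP; split; lra.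
  rewrite -mulr_suml -natr_sum -big_mkcondr.
  rewrite (eq_bigl (mem (cycle_graph 6))); last first.
    by move=> e /=; rewrite andbC; case: (boolP (e \in cycle_graph 6)) => // /(fintype.subsetP sub6).
  by rewrite sum1_card card6 divff ?pnatr_eq0.
have copy6 : cycle_graph 6 \in cycle_copies 6 (complete_graph 'I_6).
  apply/cycle_copies6P; exists [ffun i => i].
    by move=> i j; rewrite !ffunE.
  by apply: eq_imset => i; rewrite !ffunE.
rewrite /cycle_mass (bigD1 _ copy6) /=.
have -> : graph_mass mu (cycle_graph 6) = 6 ^- 6.
  rewrite /graph_mass (eq_bigr (fun=> 6^-1)); last by move=> e; rewrite /mu => ->; rewrite mul1r.
  by rewrite prodr_const card6 exprVn.
rewrite lerDl; apply: sumr_ge0 => C _; apply: prodr_ge0 => e _.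
by rewrite /mu divr_ge0.
Qed.

Theorem theorem3p5 (R : realType) : max_cycle_mass R 6 = (6%:R : R) ^- 6.
Proof.
have [X [mu [mu_prob mu_ge]]] := uniform_cycle6 R.
apply/eqP; rewrite eq_le; apply/andP; split.
  apply: ge_sup; first by exists (cycle_mass mu 6), X, mu.
  by move=> _ [Y [nu [nu_prob ->]]]; apply: cycle_mass6_le.
apply: le_trans mu_ge _; apply: ub_le_sup; last by exists X, mu.
by exists (6 ^- 6) => _ [Y [nu [nu_prob ->]]]; apply: cycle_mass6_le.
Qed.
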